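(* In a transparent region (an open set of radii $r>0$) where the absorption opacity satisfies $\kappa_{\rm a}>0$ and $\kappa_{\rm a}=\mathcal O(\varepsilon)$, where the trapped distribution $J^t$ is locally constant in $r$, and where the streaming distribution $J^s\ge 0$ satisfies $J^s<B$, the diffusion source $\Sigma$ satisfies $$\Sigma\neq \kappa_{\rm a}B,$$ that is, the IDSA does not choose the free streaming regime in this case.
   Context: $\kappa_{\rm a}(r)$ and $\kappa_{\rm s}(r)\ge 0$ are the absorption and scattering opacities, $\kappa:=\kappa_{\rm a}+\kappa_{\rm s}$ is the total opacity, and $B$ is the angle-integrated equilibrium distribution. $\varepsilon>0$ is a small parameter; a region is called transparent when the opacity is small. $J^t(t,r)$ and $J^s(t,r)$ are the distributions of trapped and of streaming particles. The diffusion source of the Isotropic Diffusion Source Approximation (IDSA) is $$\Sigma:=\min\left\{\max\left[-\frac{1}{r^2}\partial_r\left(\frac{r^2}{3\kappa}\partial_r J^t\right)+\kappa_{\rm a}J^s,\,0\right],\ \kappa_{\rm a}B\right\}.$$ The free streaming regime of the IDSA is by definition the case $\Sigma=\kappa_{\rm a}B$. *)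

(* Defs.v *)
From HB Require Import structures.
From mathcomp Require Import all_boot all_order all_algebra.
From mathcomp Require Import all_classical all_reals all_analysis.
Set Implicit Arguments.
Unset Strict Implicit.
Unset Printing Implicit Defensive.
Import Order.TTheory GRing.Theory Num.Theory.
Import numFieldNormedType.Exports.
Local Open Scope classical_set_scope.
Local Open Scope ring_scope.

Section IDSA.
Variable R : realType.

Definition locally_constant_on (U : set R) (f : R -> R) : Prop :=
  forall r, U r -> \forall s \near r, f s = f r.

(* [kappa eps r] is a family of opacities; the bound is uniform in [r] on [U]
   as [eps] tends to 0 from the right. *)
Definition opacity_bigO_eps (U : set R) (kappa : R -> R -> R) : Prop :=
  (fun p : R * R => kappa p.1 p.2)
    =O_ (FilterType (filter_prod (0 : R)^'+ (globally U)) _) (fun p : R * R => p.1).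

(* [Jt], [Js] and [B] are functions of time and radius, the opacities of the
   radius only; the derivatives are with respect to the radius. *)
Definition diffusion_source (ka ks : R -> R) (B Jt Js : R -> R -> R)
    (t r : R) : R :=
  let kappa x := ka x + ks x in
  let flux x := x ^+ 2 / (3 * kappa x) * derive1 (Jt t) x in
  Num.min
    (Num.max (- (1 / r ^+ 2 * derive1 flux r) + ka r * Js t r) 0)
    (ka r * B t r).

Definition free_streaming (ka ks : R -> R) (B Jt Js : R -> R -> R)
    (t r : R) : Prop :=
  diffusion_source ka ks B Jt Js t r = ka r * B t r.

End IDSA.

(* Main.v *)
Require Import Defs.
From HB Require Import structures.
From mathcomp Require Import all_boot all_order all_algebra.
From mathcomp Require Import all_classical all_reals all_analysis.
Import Order.TTheory GRing.Theory Num.Theory.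
Import numFieldNormedType.Exports.
Local Open Scope classical_set_scope.
Local Open Scope ring_scope.

(** Local constancy of [Jt t] makes the flux vanish near [r], hence also its radial derivative, by
    [near_cst_derive1] used twice. The source thus reduces to [kappa_a * Js], and [Js < B] with
    [kappa_a > 0] puts it strictly below the cap [kappa_a * B]. *)

(* [near_join] is what upgrades vanishing at [x] to vanishing near [x], so that
   the lemma can be applied again to a flux involving the derivative. *)
Lemma near_cst_derive1 (R : realType) (f : R -> R) (c x : R) :
  (\forall y \near x, f y = c) -> \forall y \near x, derive1 f y = 0.
Proof.
move=> /near_join; apply: filterS => y fc.
by rewrite derive1E (near_eq_derive (g := cst c)) ?oner_neq0 // derive_cst.
Qed.

Theorem proposition1 (R : realType)
  (U : set R) (U_open : open U) (U_pos : forall r, U r -> 0 < r)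
  (kappa_a kappa_s : R -> R -> R)
  (kappa_a_ge0 : forall eps r, 0 < eps -> 0 < r -> 0 <= kappa_a eps r)
  (kappa_s_ge0 : forall eps r, 0 < eps -> 0 < r -> 0 <= kappa_s eps r)
  (kappa_a_gt0 : forall eps r, 0 < eps -> U r -> 0 < kappa_a eps r)
  (kappa_a_bigO : opacity_bigO_eps U kappa_a)
  (eps : R) (eps_gt0 : 0 < eps)
  (B Jt Js : R -> R -> R) (t : R)
  (Jt_const : locally_constant_on U (Jt t))
  (Js_ge0 : forall r, U r -> 0 <= Js t r)
  (Js_ltB : forall r, U r -> Js t r < B t r) :
  forall r, U r ->
    ~ free_streaming (kappa_a eps) (kappa_s eps) B Jt Js t r.
Proof.
move=> r Ur.
rewrite /free_streaming /diffusion_source.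
set flux := fun x : R => _.
(* The factor [derive1 (Jt t) x] vanishes, whatever the coefficient in front of it, so the opacities
   are never differentiated. *)
have flux0 : \forall x \near r, flux x = 0.
  apply: filterS (near_cst_derive1 _ _ _ _ (Jt_const r Ur)) => x Jt'0.
  by rewrite /flux Jt'0 mulr0.
have -> : derive1 flux r = 0.
  exact: nbhs_singleton (near_cst_derive1 _ _ _ _ flux0).
have ka_gt0 := kappa_a_gt0 _ _ eps_gt0 Ur.
(* The max with 0 is inactive because [kappa_a * Js] is nonnegative. *)
rewrite mulr0 oppr0 add0r max_l; last by rewrite mulr_ge0 ?Js_ge0 // ltW.
have lt_JsB : kappa_a eps r * Js t r < kappa_a eps r * B t r.
  by rewrite ltr_pM2l ?Js_ltB.
by rewrite min_l ?ltW // => eqJsB; rewrite eqJsB ltxx in lt_JsB.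
Qed.
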